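(* Let $V$ be an $\mathbb R$-graded vertex operator superalgebra with conformal vector $\omega$ of central charge $c$, let $h\in V_{\bar 0,1}$ be a Heisenberg vector, $g=\exp(2\pi i h(0))$, and let $M$ be a $V$-module. Let $f$ be an automorphism commuting with $g$ and with the parity automorphism $\sigma$ (and acting on $M$). Put $$U=\Delta(-h,1)=\exp\Big(\sum_{n\ge1}\frac{h(n)}{n}(-1)^n\Big).$$ Then for all $v_1,\dots,v_n\in V$ the orbifold $g$-twisted $n$-point function and the $h$-shifted untwisted $n$-point function are related by $$F_M((f,g);(v_1,z_1),\dots,(v_n,z_n);\tau)=F_{M,h}(f;(Uv_1,z_1),\dots,(Uv_n,z_n);\tau).$$
   Context: An $\mathbb R$-graded vertex operator superalgebra (VOSA) is $(V,Y,\mathbf 1,\omega)$ with $V=V_{\bar 0}\oplus V_{\bar 1}$ a complex superspace graded by real $L(0)$-eigenvalues bounded below, $V=\bigoplus_{r\ge r_0}V_r$, with vertex operators $Y(a,z)=\sum_{n\in\mathbb Z}a(n)z^{-n-1}$ satisfying the usual superalgebra axioms (vacuum, creation, super-locality, translation), and $Y(\omega,z)=\sum_nL(n)z^{-n-2}$ generating a Virasoro algebra of central charge $c$. $\sigma a=(-1)^{p(a)}a$ is the parity automorphism. A $V$-module $(M,Y_M)$ is stable under $\sigma$ and $f$ (i.e. these act on $M$ compatibly with $Y_M$), and gradings are such that the supertraces below make sense. $\mathrm{STr}_M(X)=\mathrm{Tr}_{M_{\bar 0}}(X)-\mathrm{Tr}_{M_{\bar 1}}(X)$. A Heisenberg vector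 is $h\in V_{\bar 0,1}$ such that: $h(0)$ is semisimple with real eigenvalues; $L(n)h=0$ for all $n\ge1$; $h(n)h=0$ for all $n\ge0$ except $n=1$, where $h(1)h=\xi_h\mathbf 1$ for some $\xi_h\in\mathbb C$; and $[h(m),h(n)]=\xi_h m\delta_{m,-n}$. Define $\Delta(h,z)=z^{h(0)}\exp\big(-\sum_{n\ge1}\frac{h(n)}{n}(-z)^{-n}\big)$, so $\Delta(h,z)^{-1}=\Delta(-h,z)$. The $g$-twisted module is $(M,Y_g)$ with $Y_g(v,z)=Y_M(\Delta(-h,z)v,z)$; its grading operator (the coefficient of $z^{-2}$ in $Y_g(\omega,z)$) is $L_g(0)=L(0)-h(0)+\xi_h/2$. With $q=e^{2\pi i\tau}$, $q_i=e^{z_i}$ (and $q_i^{A}=\exp(z_iA)$), the orbifold $g$-twisted $n$-point function is $$F_M((f,g);(v_1,z_1),\dots,(v_n,z_n);\tau)=\mathrm{STr}_M\!\left(f\,Y_g(q_1^{L(0)}v_1,q_1)\cdots Y_g(q_n^{L(0)}v_n,q_n)\,q^{L_g(0)-c/24}\right).$$ The $h$-shifted VOSA is $(V,Y,\mathbf 1,\omega_h)$ with $\omega_h=\omega+h(-2)\mathbf 1$, for which $L_h(n)=L(n)-(n+1)h(n)$, in particular $L_h(0)=L(0)-h(0)$, and the central charge is $c_h=c-12\xi_h$. The $h$-shifted $n$-point function is $$F_{M,h}(f;(v_1,z_1),\dots,(v_n,z_n);\tau)=\mathrm{STr}_M\!\left(f\,Y_M(q_1^{L_h(0)}v_1,q_1)\cdots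 Y_M(q_n^{L_h(0)}v_n,q_n)\,q^{L_h(0)-c_h/24}\right).$$ *)

(* Defs.v *)
From HB Require Import structures.
From mathcomp Require Import all_boot all_order all_algebra.
From mathcomp Require Import complex.
From mathcomp Require Import mathcomp_extra boolp classical_sets cardinality.
From mathcomp Require Import fsbigop reals.
From mathcomp Require Import sequences exp trigo.

Set Implicit Arguments.
Unset Strict Implicit.
Unset Printing Implicit Defensive.

Import Order.TTheory GRing.Theory Num.Theory.

Local Open Scope classical_set_scope.
Local Open Scope ring_scope.
Local Open Scope complex_scope.

(* The complex numbers are R[i] with R : realType. The sums
   "\sum_(i \in A) F i" over classical sets are the finitely supported sums
   of fsbigop, used only where the support is finite. *)

Section ComplexAnalysis.
Variable R : realType.
Local Notation C := R[i].

Definition cexp (z : C) : C :=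
  (expR (complex.Re z))%:C *
  (cos (complex.Im z) +i* sin (complex.Im z)).

Definition twopii : C := (2 * pi) *i.

(* Unconditional convergence, along the net of finite subsets of I. *)
Definition has_sum (I : choiceType) (F : I -> C) (l : C) : Prop :=
  forall e : R, 0 < e -> exists s0 : seq I, forall s : seq I,
    uniq s -> {subset s0 <= s} -> `|\sum_(i <- s) F i - l| < e%:C.

(* The binomial coefficient "m choose j" for an integer m. *)
Definition gbinom (m : int) (j : nat) : C :=
  (\prod_(i < j) (m - i%:Z)%:~R) / j`!%:R.

End ComplexAnalysis.

Section Operators.
Variables (R : realType) (V : lmodType R[i]).
Local Notation C := R[i].
Implicit Types (T : V -> V) (v w : V).

(* V is the sum of the eigenspaces of T with eigenvalues in P. *)
Definition diagonalizable_on T (P : set C) : Prop :=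
  forall v, exists m (u : 'I_m -> V) (lam : 'I_m -> C),
    (forall i, P (lam i) /\ T (u i) = lam i *: u i) /\ v = \sum_i u i.

Definition findim_eigenspaces T : Prop :=
  forall lam : C, exists m (e : 'I_m -> V), forall v, T v = lam *: v ->
    exists a : 'I_m -> C, v = \sum_i a i *: e i.

(* The component of v in the lam-eigenspace of T (T diagonalizable): the
   decomposition of v into eigenvectors is unique. *)
Definition eigc T (lam : C) v : V :=
  xget 0 [set w | exists d : C -> V,
    [/\ finite_set [set mu | d mu != 0],
        forall mu, T (d mu) = mu *: d mu,
        v = \sum_(mu \in [set: C]) d mu &
        w = d lam]].

(* phi(T) for T diagonalizable. *)
Definition opfun (phi : C -> C) T v : V :=
  \sum_(lam \in [set: C]) phi lam *: eigc T lam v.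

(* z^T at z = e^zeta, i.e. exp(zeta T), for T diagonalizable. *)
Definition qpow (zeta : C) T : V -> V := opfun (fun lam => cexp (zeta * lam)) T.

(* exp(T) for T locally nilpotent. *)
Definition lnexp T v : V := \sum_(k \in [set: nat]) (k`!%:R)^-1 *: iter k T v.

(* The coefficient of z^s in F = \sum_s d_s z^s (a finite sum of complex
   powers), where F is given through zeta |-> F(e^zeta), z^s being
   e^(s zeta); the coefficients are unique since the functions e^(s zeta) are
   linearly independent. *)
Definition zcoef (F : C -> V) (s : C) : V :=
  xget 0 [set w | exists d : C -> V,
    [/\ finite_set [set t | d t != 0],
        forall zeta, F zeta = \sum_(t \in [set: C]) cexp (t * zeta) *: d t &
        w = d s]].

(* The trace of a finite rank operator T = \sum_i phi_i(_) e_i is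
   \sum_i phi_i(e_i). *)
Definition has_trace T (t : C) : Prop :=
  exists m (e : 'I_m -> V) (phi : 'I_m -> {scalar V}),
    (forall v, T v = \sum_i phi i v *: e i) /\ t = \sum_i phi i (e i).

Definition trace T : C := xget 0 [set t | has_trace T t].

(* A superspace is encoded by its parity involution sigma: the elements of
   parity p are the a with sigma a = (-1)^p a. *)
Definition has_parity (sigma : V -> V) (p : bool) v : Prop :=
  sigma v = (-1) ^+ p *: v.

Definition parity_proj (sigma : V -> V) (p : bool) v : V :=
  2^-1 *: (v + (-1) ^+ p *: sigma v).

Definition trace_parity (sigma : V -> V) (p : bool) T : C :=
  trace (parity_proj sigma p \o T \o parity_proj sigma p).

Definition supertrace (sigma : V -> V) T : C :=
  trace_parity sigma false T - trace_parity sigma true T.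

End Operators.

(* vY A a n b is the n-th product a(n)b, where Y(a,z) = \sum_n a(n) z^(-n-1). *)
Record vosa (R : realType) (V : lmodType R[i]) := Vosa {
  vsigma : {linear V -> V};
  vY : V -> int -> {linear V -> V};
  vac : V;
  omega : V;
  charge : R[i];
  vsigmaK : involutive vsigma;
  vsigma_vac : vsigma vac = vac;
  vsigma_omega : vsigma omega = omega;
  vsigma_prod : forall a n b, vsigma (vY a n b) = vY (vsigma a) n (vsigma b);
  vY_linear : forall n b, linear (fun a => vY a n b);
  vY_trunc : forall a b, exists N : int, forall n, N <= n -> vY a n b = 0;
  vY_vac : forall n b, vY vac n b = if n == -1 then b else 0;
  vY_creation : forall a,
    vY a (-1) vac = a /\ forall n : int, 0 <= n -> vY a n vac = 0;
  (* (z - w)^N [Y(a,z), Y(b,w)] = 0, supercommutator, mode by mode *)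
  vY_locality : forall p q a b,
    has_parity vsigma p a -> has_parity vsigma q b ->
    exists N : nat, forall (m n : int) v,
      \sum_(j < N.+1) ((-1) ^+ j *+ 'C(N, j)) *:
        (vY a (m + N%:Z - j%:Z) (vY b (n + j%:Z) v) -
         (-1) ^+ (p && q) *: vY b (n + j%:Z) (vY a (m + N%:Z - j%:Z) v)) = 0;
  (* [L(-1), Y(a,z)] = d/dz Y(a,z) *)
  vY_translation : forall a n b,
    vY omega 0 (vY a n b) - vY a n (vY omega 0 b) =
    (- n%:~R) *: vY a (n - 1) b;
  (* L(n) = omega(n+1) *)
  virasoro : forall (m n : int) v,
    vY omega (m + 1) (vY omega (n + 1) v) -
    vY omega (n + 1) (vY omega (m + 1) v) =
    (m - n)%:~R *: vY omega (m + n + 1) v +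
    (if m + n == 0 then ((m ^+ 3 - m)%:~R / 12 * charge) *: v else 0);
  vgrading : exists r0 : R,
    diagonalizable_on (vY omega 1) [set lam | exists2 r : R, r0 <= r & lam = r%:C]
}.

Section Vosa.
Variables (R : realType) (V : lmodType R[i]) (A : vosa V).
Local Notation C := R[i].

Definition is_automorphism (f : {linear V -> V}) : Prop :=
  [/\ bijective f, f (vac A) = vac A, f (omega A) = omega A &
      forall a n b, f (vY A a n b) = vY A (f a) n (f b)].

Definition is_heisenberg (h : V) (xi : C) : Prop :=
  has_parity (vsigma A) false h /\ vY A (omega A) 1 h = h /\
  diagonalizable_on (vY A h 0) [set lam | exists r : R, lam = r%:C] /\
  (forall n : int, 1 <= n -> vY A (omega A) (n + 1) h = 0) /\
  (forall n : int, 0 <= n -> vY A h n h = if n == 1 then xi *: vac A else 0) /\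
  (forall (m n : int) v,
     vY A h m (vY A h n v) - vY A h n (vY A h m v) =
     if m == - n then (xi * m%:~R) *: v else 0).

(* g = exp(2 pi i h(0)) *)
Definition heis_aut (h : V) : V -> V := qpow (twopii R) (vY A h 0).

(* Delta(h, z) at z = e^zeta *)
Definition Delta (h : V) (zeta : C) (v : V) : V :=
  qpow zeta (vY A h 0)
    (lnexp (fun u => - \sum_(n \in [set n : nat | (0 < n)%N])
              ((- cexp zeta) ^- n / n%:R) *: vY A h n%:Z u) v).

(* U = exp(\sum_(n >= 1) h(n)/n (-1)^n) *)
Definition Uop (h : V) : V -> V :=
  lnexp (fun u => \sum_(n \in [set n : nat | (0 < n)%N])
           ((-1) ^+ n / n%:R) *: vY A h n%:Z u).

Definition omega_sh (h : V) : V := omega A + vY A h (-2) (vac A).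

Definition charge_sh (xi : C) : C := charge A - 12 * xi.

(* A V-module, as a superspace on which sigma acts compatibly with Y_M. *)
Record vmodule (M : lmodType C) := Vmodule {
  msigma : {linear M -> M};
  mY : V -> int -> {linear M -> M};
  msigmaK : involutive msigma;
  msigma_act : forall a n u, msigma (mY a n u) = mY (vsigma A a) n (msigma u);
  mY_linear : forall n u, linear (fun a => mY a n u);
  mY_trunc : forall a u, exists N : int, forall n, N <= n -> mY a n u = 0;
  mY_vac : forall n u, mY (vac A) n u = if n == -1 then u else 0;
  (* the Jacobi identity, in modes (Borcherds identity) *)
  mY_jacobi : forall p q a b,
    has_parity (vsigma A) p a -> has_parity (vsigma A) q b ->
    forall (l m n : int) u,
      \sum_(j \in [set: nat])
        gbinom R m j *: mY (vY A a (l + j%:Z) b) (m + n - j%:Z) u =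
      \sum_(j \in [set: nat]) ((-1) ^+ j * gbinom R l j) *:
        (mY a (l + m - j%:Z) (mY b (n + j%:Z) u) -
         ((-1) ^ l * (-1) ^+ (p && q)) *:
           mY b (l + n - j%:Z) (mY a (m + j%:Z) u))
}.

Section Module.
Variables (M : lmodType C) (B : vmodule M).

Definition acts_on_module (f : {linear V -> V}) (fM : {linear M -> M}) : Prop :=
  bijective fM /\ forall a n u, fM (mY B a n u) = mY B (f a) n (fM u).

(* A field at the point z = e^zeta, as its Z-indexed family of terms:
   here a(k) z^(-k-1), for Y_M(a, z). *)
Definition YM_at (a : V) (zeta : C) (k : int) (u : M) : M :=
  cexp (- (k + 1)%:~R * zeta) *: mY B a k u.

(* Y_g(v, z) = Y_M(Delta(-h, z) v, z) at z = e^zeta *)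
Definition Yg_at (h v : V) (zeta : C) : int -> M -> M :=
  YM_at (Delta (- h) zeta v) zeta.

(* The coefficient of z^r in Y_g(v, z) = \sum_s \sum_k z^s z^(-k-1) v_s(k),
   where Delta(-h, z) v = \sum_s z^s v_s. *)
Definition Yg_coef (h v : V) (r : C) (u : M) : M :=
  \sum_(k \in [set: int])
    mY B (zcoef (fun zeta => Delta (- h) zeta v) (r + (k + 1)%:~R)) k u.

Definition Lg0 (h : V) : M -> M := Yg_coef h (omega A) (-2).

Variables (n : nat) (fM : M -> M).

(* The expansion of STr_M(f X_1 ... X_n q^K), for X_i = \sum_k X_i(k) and K
   diagonalizable, is \sum_r q^r \sum_k nterm r k, with r in C and k in Z^n. *)
Definition nterm (X : 'I_n -> int -> M -> M) (K : M -> M)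
    (r : C) (k : {ffun 'I_n -> int}) : C :=
  supertrace (msigma B)
    (fun u => fM (foldr (fun i w => X i (k i) w) (eigc K r u) (enum 'I_n))).

(* For each r the sum over k in Z^n converges absolutely, and so does the sum
   over r of the resulting coefficients of q^r; w is the value. The value
   nvalue is 0 by convention when the series does not converge. *)
Definition nsum (t : C -> {ffun 'I_n -> int} -> C) (tau w : C) : Prop :=
  exists S : C -> C, (forall r, has_sum (t r) (S r)) /\
    has_sum (fun r => cexp (twopii R * tau * r) * S r) w.

Definition nvalue (t : C -> {ffun 'I_n -> int} -> C) (tau : C) : C :=
  xget 0 [set w | nsum t tau w].

Definition twisted_series (h : V) (v : 'I_n -> V) (z : 'I_n -> C) :=
  nterm (fun i => Yg_at h (qpow (z i) (vY A (omega A) 1) (v i)) (z i))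
        (fun u => Lg0 h u - (charge A / 24) *: u).

Definition shifted_series (h : V) (xi : C) (v : 'I_n -> V) (z : 'I_n -> C) :=
  nterm (fun i => YM_at (qpow (z i) (vY A (omega_sh h) 1) (v i)) (z i))
        (fun u => mY B (omega_sh h) 1 u - (charge_sh xi / 24) *: u).

(* F_M((f,g); (v_1,z_1), ..., (v_n,z_n); tau) *)
Definition F_twisted (h : V) (v : 'I_n -> V) (z : 'I_n -> C) (tau : C) : C :=
  nvalue (twisted_series h v z) tau.

(* F_(M,h)(f; (v_1,z_1), ..., (v_n,z_n); tau) *)
Definition F_shifted (h : V) (xi : C) (v : 'I_n -> V) (z : 'I_n -> C)
    (tau : C) : C :=
  nvalue (shifted_series h xi v z) tau.

End Module.
End Vosa.

(* Main.v *)
From HB Require Import structures.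
Require Import Defs.
From mathcomp Require Import all_boot all_order all_algebra.
From mathcomp Require Import complex.
From mathcomp Require Import reals.
From mathcomp Require Import boolp classical_sets functions cardinality fsbigop.
From mathcomp Require Import sequences exp trigo.
From mathcomp Require Import zify ring.

(* The two series agree term by term, because the operators under the supertrace
   agree. On V, e^(zeta L(0)) h(n) e^(-zeta L(0)) = e^(-n zeta) h(n) gives
   Delta(-h, z) z^L(0) = z^(L(0) - h(0)) Delta(-h, 1), and Y_g(omega, z) is computed
   from Delta(-h, z) omega = omega - z^-1 h + z^-2 (xi / 2) vac, whence
   L_g(0) = L(0) - h(0) + xi / 2. Both rest on [L(p), h(n)] = -n h(n + p) and
   (L(-1) a)(n) = -n a(n - 1) on V, which follow from locality, translation and
   creation through Goddard's uniqueness theorem and Dong's lemma. *)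

Import Order.TTheory GRing.Theory Num.Theory.
Local Open Scope ring_scope.
Local Open Scope complex_scope.

Set Implicit Arguments.
Unset Strict Implicit.
Unset Printing Implicit Defensive.

(** The axioms of [vosa] give locality but not the Borcherds identity, so no commutator formula on V
    is available at the start. For p >= 0 the mode omega(p) kills the vacuum, and a bracket with
    h(n) can be identified by its action there; locality then carries the formula to p < 0, and p =
    -1 gives h(n) omega, the input for Delta(-h, z) omega. The values [eigc], [opfun] and [zcoef]
    are chosen ones, so every computation with them rests on uniqueness: independence of
    eigenvectors, and of exponentials. The exponent of Delta is not shown to be locally nilpotent:
    the invertibility of z^L(0) transports its exponential, and on omega the series is computed
    outright. *)

Section FiniteSums.
Local Open Scope classical_set_scope.

Lemma fsum_seq (W : nmodType) (I : choiceType) (A : set I) (F : I -> W)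
    (s : seq I) :
  uniq s -> (forall i, i \in s -> A i) ->
  (forall i, A i -> i \notin s -> F i = 0) ->
  \sum_(i \in A) F i = \sum_(i <- s) F i.
Proof.
move=> us sA F0; rewrite [RHS]fsbig_seq// (fsbig_widen [set` s] A)// => i [Ai si].
by apply: F0 => //; apply/negP.
Qed.

(* No finiteness is assumed: an injective map preserves the support, so on both
   sides the sum takes the same junk value 0 when the support is infinite. *)
Lemma fsum_inj (W W' : zmodType) (S : W -> W') (I : choiceType)
    (A : set I) (F : I -> W) :
  injective S -> S 0 = 0 -> {morph S : x y / x + y} ->
  S (\sum_(i \in A) F i) = \sum_(i \in A) S (F i).
Proof.
move=> Sinj S0 SD; rewrite (big_morph S SD S0); congr (\sum_(i <- _) _).
rewrite /finite_support !unlock.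
suff -> : F @^-1` [set~ 0] = (fun i => S (F i)) @^-1` [set~ 0] by [].
apply/seteqP; split=> i /= Fi0; last by move=> F0; apply: Fi0; rewrite F0 S0.
by move=> SF0; apply: Fi0; apply: Sinj; rewrite S0.
Qed.

End FiniteSums.

Lemma morphD0 (W W' : zmodType) (f : W -> W') :
  {morph f : x y / x + y} -> f 0 = 0.
Proof. by move=> fD; have /eqP := fD 0 0; rewrite addr0 -subr_eq subrr => /eqP. Qed.

Lemma linear_morph (K : pzRingType) (U W : lmodType K) (f : U -> W) :
  linear f ->
  [/\ f 0 = 0, {morph f : x y / x + y} & forall a x, f (a *: x) = a *: f x].
Proof.
move=> flin; have fD : {morph f : x y / x + y}.
  by move=> x y; have := flin 1 x y; rewrite !scale1r.
have f0 := morphD0 fD; split=> // a x; have := flin a x 0.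
by rewrite f0 !addr0.
Qed.

(** Independence of characters: applying [T x - chi i0 x] removes the term at [i0] from a relation.
    A whole family [T] is allowed because exponential functions are separated by the family of all
    translations. *)
Lemma joint_eigenvectors_free (K : fieldType) (W : lmodType K) (I : eqType)
    (X : Type) (T : X -> {linear W -> W}) (chi : I -> X -> K)
    (chi_inj : forall i j, (forall x, chi i x = chi j x) -> i = j)
    (s : seq I) (e : I -> W) :
  uniq s -> (forall i x, T x (e i) = chi i x *: e i) ->
  \sum_(i <- s) e i = 0 -> forall i, i \in s -> e i = 0.
Proof.
elim: s e => // i0 s IH e /= /andP[i0s us] Te; rewrite big_cons => e0.
have es i : i \in s -> e i = 0.
  move=> si; apply: contrapT => ei0; apply: (negP i0s); suff -> : i0 = i by [].
  apply: chi_inj => x; apply: contrapT => neq; apply: ei0.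
  have /(_ i si)/eqP : forall i, i \in s -> (chi i x - chi i0 x) *: e i = 0.
    apply: IH => // [j y|]; first by rewrite linearZ/= Te !scalerA mulrC.
    have eqN : \sum_(j <- s) e j = - e i0 by apply/eqP; rewrite -addr_eq0 addrC e0.
    under eq_bigr do rewrite scalerBl -Te.
    by rewrite sumrB -scaler_sumr -linear_sum eqN linearN /= Te scalerN subrr.
  by rewrite scaler_eq0 subr_eq0 => /orP[/eqP /esym|/eqP].
move=> i; rewrite inE => /orP[/eqP ->|]; last exact: es.
by move: e0; rewrite big_seq big1 ?addr0// => j /es.
Qed.

Lemma eigenvectors_free (K : fieldType) (W : lmodType K) (T : {linear W -> W})
    (s : seq K) (e : K -> W) :
  uniq s -> (forall mu, T (e mu) = mu *: e mu) ->
  \sum_(mu <- s) e mu = 0 -> forall mu, mu \in s -> e mu = 0.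
Proof.
move=> us Te; apply: (joint_eigenvectors_free (X := unit) (T := fun=> T)
          (chi := fun mu => fun=> mu)) => //.
by move=> i j /(_ tt).
Qed.

Lemma sum_fibers (W : nmodType) (I : finType) (K : eqType) (lam : I -> K)
    (F : I -> W) :
  \sum_(nu <- undup (codom lam)) \sum_(i | lam i == nu) F i = \sum_i F i.
Proof.
rewrite (exchange_big_dep xpredT)//=; apply: eq_bigr => i _.
rewrite big_mkcond (bigD1_seq (lam i)) ?undup_uniq ?mem_undup ?codom_f//= eqxx.
by rewrite big1 ?addr0// => nu; rewrite eq_sym => /negPf ->.
Qed.

(** * Functional calculus of diagonalizable operators *)

Section FunctionalCalculus.
Variables (R : realType) (V : lmodType R[i]).
Local Notation C := R[i].
Implicit Types (T : {linear V -> V}) (phi : C -> C).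
Local Open Scope classical_set_scope.

Lemma finite_support_seq (W : zmodType) (I : choiceType) (d : I -> W) :
  finite_set [set i | d i != 0] ->
  exists s, uniq s /\ forall i, i \notin s -> d i = 0.
Proof.
move=> /finite_seqP[s ds]; exists (undup s); split; first exact: undup_uniq.
move=> i; rewrite mem_undup => si; apply: contraNeq si => di.
by have : [set i | d i != 0] i by []; rewrite ds.
Qed.

(** Grouping the [u i] by eigenvalue gives one admissible decomposition; its difference with any
    other is a relation between eigenvectors of distinct eigenvalues, so the value chosen by [xget]
    is forced. *)
Lemma eigc_sum T m (u : 'I_m -> V) (lam : 'I_m -> C) mu :
  (forall i, T (u i) = lam i *: u i) ->
  eigc T mu (\sum_i u i) = \sum_(i | lam i == mu) u i.
Proof.
move=> Tu; pose d nu := \sum_(i | lam i == nu) u i.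
have Td nu : T (d nu) = nu *: d nu.
  by rewrite /d linear_sum scaler_sumr; apply: eq_bigr => i /eqP <-.
have d0 nu : nu \notin undup (codom lam) -> d nu = 0.
  rewrite mem_undup => nu0; rewrite /d big_pred0// => i.
  by apply: contraNF nu0 => /eqP <-; exact: codom_f.
have sumd : \sum_i u i = \sum_(nu \in [set: C]) d nu.
  rewrite (@fsum_seq _ _ _ _ (undup (codom lam))) ?undup_uniq//; last first.
    by move=> nu _; exact: d0.
  by rewrite /d sum_fibers.
rewrite /eigc; apply: xget_unique.
  exists d; split=> //; apply: (@sub_finite_set _ _ [set` undup (codom lam)]) => //.
  by move=> nu /=; apply: contra_neqT => /d0.
move=> w [d' [/finite_support_seq[s [us ds]] Td' sumd' ->]].
pose s' := undup (s ++ codom lam).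
have E nu : nu \notin s' -> d nu = 0 /\ d' nu = 0.
  rewrite mem_undup mem_cat negb_or => /andP[/ds ? ?].
  by split=> //; apply: d0; rewrite mem_undup.
rewrite -/(d mu); apply/eqP; rewrite -subr_eq0.
have [mus|/E[-> ->]] := boolP (mu \in s'); last first.
  by rewrite subrr.
apply/eqP; apply: (@eigenvectors_free _ _ T s' (fun nu => d' nu - d nu)) => //.
- exact: undup_uniq.
- by move=> nu; rewrite linearB /= Td Td' scalerBr.
rewrite sumrB; apply/eqP; rewrite subr_eq0; apply/eqP.
rewrite -(@fsum_seq _ _ setT) ?undup_uniq//; last by move=> i _ /E[].
by rewrite -sumd' sumd (@fsum_seq _ _ setT _ s') ?undup_uniq// => i _ /E[].
Qed.

Lemma opfun_sum phi T m (u : 'I_m -> V) (lam : 'I_m -> C) :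
  (forall i, T (u i) = lam i *: u i) ->
  opfun phi T (\sum_i u i) = \sum_i phi (lam i) *: u i.
Proof.
move=> Tu; rewrite /opfun (@fsum_seq _ _ _ _ (undup (codom lam))) ?undup_uniq//.
  rewrite -[RHS](sum_fibers lam); apply: eq_bigr => nu _.
  by rewrite (eigc_sum _ Tu) scaler_sumr; apply: eq_bigr => i /eqP ->.
move=> nu _; rewrite mem_undup => nu0; rewrite (eigc_sum _ Tu) big_pred0 ?scaler0// => i.
by apply: contraNF nu0 => /eqP <-; exact: codom_f.
Qed.

Lemma opfun_eigen phi T u (lam : C) :
  T u = lam *: u -> opfun phi T u = phi lam *: u.
Proof.
move=> Tu; have := @opfun_sum phi T 1 (fun=> u) (fun=> lam) (fun=> Tu).
by rewrite !big_ord1.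
Qed.

Lemma diagonalizable_ind T (P : set C) (Q : V -> Prop) :
  diagonalizable_on T P ->
  (forall u w, Q u -> Q w -> Q (u + w)) ->
  (forall u lam, T u = lam *: u -> Q u) -> forall v, Q v.
Proof.
move=> dT QD Qe v; have [m [u [lam [Tu ->]]]] := dT v.
elim/big_ind: _ => //; first by apply: (Qe _ 0); rewrite linear0 scaler0.
by move=> i _; exact: Qe (Tu i).2.
Qed.

(** For the linearity of [opfun]: decompositions of two vectors concatenate to one of their sum, on
    which [phi] acts entry by entry. *)
Lemma eigen_cat T m (u : 'I_m -> V) (lam : 'I_m -> C)
    p (t : 'I_p -> V) (mu : 'I_p -> C) :
  (forall i, T (u i) = lam i *: u i) -> (forall i, T (t i) = mu i *: t i) ->
  exists (w : 'I_(m + p) -> V) (nu : 'I_(m + p) -> C),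
    [/\ forall i, T (w i) = nu i *: w i,
        \sum_i w i = \sum_i u i + \sum_i t i &
        forall phi : C -> C, \sum_i phi (nu i) *: w i =
          \sum_i phi (lam i) *: u i + \sum_i phi (mu i) *: t i].
Proof.
move=> Tu Tt.
exists (fun i => match fintype.split i with inl j => u j | inr j => t j end).
exists (fun i => match fintype.split i with inl j => lam j | inr j => mu j end).
split=> [i||phi]; first by case: (fintype.split i).
  rewrite big_split_ord /=; congr (_ + _); apply: eq_bigr => i _.
    by rewrite (unsplitK (inl i)).
  by rewrite (unsplitK (inr i)).
rewrite big_split_ord /=; congr (_ + _); apply: eq_bigr => i _.
  by rewrite (unsplitK (inl i)).
by rewrite (unsplitK (inr i)).
Qed.

Lemma opfun_linear phi T (P : set C) : diagonalizable_on T P ->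
  linear (opfun phi T).
Proof.
move=> dT a v w.
have [m [u [lam [Tu ->]]]] := dT v; have [p [t [mu [Tt ->]]]] := dT w.
have Tau i : T (a *: u i) = lam i *: (a *: u i).
  by rewrite linearZ /= (Tu i).2 !scalerA mulrC.
have [w' [nu [Tw Ew Ephi]]] := eigen_cat Tau (fun i => (Tt i).2).
rewrite scaler_sumr -Ew (opfun_sum _ Tw) Ephi (opfun_sum _ (fun i => (Tu i).2)).
rewrite (opfun_sum _ (fun i => (Tt i).2)) scaler_sumr; congr (_ + _).
by apply: eq_bigr => i _; rewrite !scalerA mulrC.
Qed.

Lemma eigc_comm T (S : {linear V -> V}) (P : set C) mu v :
  diagonalizable_on T P -> (forall u, S (T u) = T (S u)) ->
  S (eigc T mu v) = eigc T mu (S v).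
Proof.
move=> dT ST; have [m [u [lam [Tu ->]]]] := dT v.
rewrite (eigc_sum _ (fun i => (Tu i).2)) !linear_sum (@eigc_sum T _ _ lam)//= => i.
by rewrite -ST (Tu i).2 linearZ.
Qed.

(** The [T2]-components of a [T1]-eigenvector are again [T1]-eigenvectors, because [T1] commutes
    with the projections [eigc T2]. *)
Lemma joint_diagonalizable_ind (T1 T2 : {linear V -> V}) (P1 P2 : set C)
    (Q : V -> Prop) :
  diagonalizable_on T1 P1 -> diagonalizable_on T2 P2 ->
  (forall u, T1 (T2 u) = T2 (T1 u)) ->
  (forall u w, Q u -> Q w -> Q (u + w)) ->
  (forall u lam mu, T1 u = lam *: u -> T2 u = mu *: u -> Q u) ->
  forall v, Q v.
Proof.
move=> dT1 dT2 T12 QD Qe; apply: (diagonalizable_ind dT1 QD) => u lam T1u.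
have [m [w [mu [T2w uE]]]] := dT2 u; have {}T2w i := (T2w i).2.
rewrite uE -(sum_fibers mu); elim/big_ind: _ => // [|nu _].
  by apply: (Qe _ 0 0); rewrite linear0 scaler0.
rewrite -(eigc_sum _ T2w) -uE; apply: (Qe _ lam nu).
  rewrite (eigc_comm _ _ dT2 T12) T1u uE scaler_sumr.
  rewrite (@eigc_sum T2 _ (fun i => lam *: w i) mu) => [|i]; last first.
    by rewrite linearZ /= T2w !scalerA mulrC.
  by rewrite (eigc_sum _ T2w) scaler_sumr.
rewrite uE (eigc_sum _ T2w) linear_sum scaler_sumr.
by apply: eq_bigr => i /eqP <-; exact: T2w.
Qed.

Lemma diagonalizable_sub (T1 T2 T : {linear V -> V}) (P1 P2 : set C) :
  diagonalizable_on T1 P1 -> diagonalizable_on T2 P2 ->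
  (forall u, T1 (T2 u) = T2 (T1 u)) -> (forall u, T u = T1 u - T2 u) ->
  diagonalizable_on T setT.
Proof.
move=> dT1 dT2 T12 TE; apply: (joint_diagonalizable_ind dT1 dT2 T12).
  move=> _ _ [m [u [lam [Tu ->]]]] [p [t [mu [Tt ->]]]].
  have [w [nu [Tw Ew _]]] := eigen_cat (fun i => (Tu i).2) (fun i => (Tt i).2).
  by exists (m + p)%N, w, nu; rewrite Ew; split=> [i|]; [split; last exact: Tw |].
move=> u lam mu T1u T2u; exists 1%N, (fun=> u), (fun=> lam - mu).
by split=> [i|]; [rewrite TE T1u T2u scalerBl | rewrite big_ord1].
Qed.

End FunctionalCalculus.

(** * Iterates and kernels of commuting operators *)

Section CommutingOperators.
Variable W : zmodType.

Lemma subrACA (x y z t : W) : (x - y) - (z - t) = (x - z) - (y - t).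
Proof. by rewrite !opprB addrACA [RHS]addrACA [- z + _]addrC. Qed.

Implicit Types F G : W -> W.

(* [[a, b], c] = (a[b, c] - [b, c]a) - (b[a, c] - [a, c]b), the arguments being
   abc, bac, cab, cba, acb and bca. *)
Lemma commutator_split (p1 p2 p3 p4 s t : W) :
  (p1 - p2) - (p3 - p4) = ((p1 - s) - (t - p4)) - ((p2 - t) - (s - p3)).
Proof.
rewrite [RHS]subrACA [(p1 - s) - _]subrACA [(t - p4) - _]subrACA.
rewrite -[s - t]opprB opprK [in LHS]opprB [X in _ = _ + X]opprB.
by rewrite [RHS]addrACA subrr addr0.
Qed.

Lemma iter_morphB F n : {morph F : x y / x - y} -> {morph iter n F : x y / x - y}.
Proof. by move=> FB x y; elim: n => //= n ->; rewrite FB. Qed.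

Lemma iter_fix F n x : F x = x -> iter n F x = x.
Proof. by move=> Fx; elim: n => //= n ->. Qed.

Lemma iter_comm F G n : (forall x, F (G x) = G (F x)) ->
  forall x, iter n F (G x) = G (iter n F x).
Proof. by move=> FG x; elim: n => //= n ->. Qed.

(** Every term of the binomial expansion of (Q - P)^(i + j) contains P^i or Q^j. The double
    induction avoids the expansion: writing one factor [R] as [Q - P] lowers either [j] or [i]. *)
Lemma iter_sub_kernel (P Q R : W -> W) :
  {morph P : x y / x - y} -> {morph Q : x y / x - y} ->
  (forall x, P (Q x) = Q (P x)) -> (forall x, R x = Q x - P x) ->
  forall i j a x, iter i P x = 0 -> iter a R (iter j Q x) = 0 ->
  iter (a + i + j) R x = 0.
Proof.
move=> PB QB PQ RE.
have P0 : P 0 = 0 by rewrite -{1}(subrr 0) PB subrr.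
have Q0 : Q 0 = 0 by rewrite -{1}(subrr 0) QB subrr.
have RB : {morph R : x y / x - y}.
  by move=> x y; rewrite !RE PB QB subrACA.
have R0 : R 0 = 0 by rewrite -{1}(subrr 0) RB subrr.
have RP x : R (P x) = P (R x) by rewrite !RE PB PQ.
elim=> [|i IHi] j a x; first by move=> /= -> _; exact: iter_fix.
elim: j x => [|j IHj] x Pix RQx.
  by rewrite addn0 addnC iterD RQx iter_fix.
rewrite addnS iterSr RE (iter_morphB _ RB) IHj; first last.
- by rewrite -iterSr.
- by rewrite (iter_comm _ PQ) Pix.
rewrite addnS addSnnS IHi ?subrr//; first by rewrite -iterSr.
rewrite (iter_comm _ (fun x => esym (PQ x))).
by rewrite (iter_comm _ RP) RQx.
Qed.

End CommutingOperators.

(** * Formal distributions killed by a power of z - w *)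

Section Locality.

(* Multiplication by z - w on coefficients: G m n is the coefficient of
   z^(-m-1) w^(-n-1) in G(z, w). *)
Definition zw (W : zmodType) (G : int -> int -> W) (m n : int) : W :=
  G (m + 1) n - G m (n + 1).

Definition zw_torsion (W : zmodType) (G : int -> int -> W) : Prop :=
  exists N, forall m n, iter N (@zw W) G m n = 0.

Lemma zwB (W : zmodType) : {morph @zw W : G H / G - H}.
Proof.
move=> G H; apply/funext => m; apply/funext => n.
exact: subrACA.
Qed.

Lemma iter_zw_morph (W W' : zmodType) (f : W -> W') (G : int -> int -> W) N :
  {morph f : x y / x - y} -> forall m n,
  f (iter N (@zw W) G m n) = iter N (@zw W') (fun p q => f (G p q)) m n.
Proof. by move=> fB; elim: N => //= N IH m n; rewrite /zw fB !IH. Qed.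

Lemma iter_zw0 (W : zmodType) N m n : iter N (@zw W) (fun _ _ => 0) m n = 0.
Proof. by elim: N m n => //= N IH m n; rewrite /zw !IH subrr. Qed.

Lemma iter_zw_le (W : zmodType) (G : int -> int -> W) N K : (N <= K)%N ->
  (forall m n, iter N (@zw W) G m n = 0) -> forall m n, iter K (@zw W) G m n = 0.
Proof.
move=> /subnK <- GN; rewrite iterD.
have -> : iter N (@zw W) G = fun _ _ => 0 by apply/funext => m; apply/funext => n.
exact: iter_zw0.
Qed.

Lemma eq_zw_torsion (W : zmodType) (G H : int -> int -> W) :
  (forall m n, G m n = H m n) -> zw_torsion G -> zw_torsion H.
Proof. by move=> /(fun e m => funext (e m))/funext ->. Qed.

Lemma zw_torsionB (W : zmodType) (G H : int -> int -> W) :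
  zw_torsion G -> zw_torsion H -> zw_torsion (fun m n => G m n - H m n).
Proof.
move=> [N GN] [K HK]; exists (N + K)%N => m n.
rewrite -[fun m n => _]/(G - H) (iter_morphB _ (@zwB W)) -[LHS]/(_ - _).
by rewrite (iter_zw_le _ GN) ?leq_addr// (iter_zw_le _ HK) ?leq_addl// subrr.
Qed.

Lemma zw_torsion_morph (W W' : zmodType) (f : W -> W') (G : int -> int -> W) :
  {morph f : x y / x - y} -> zw_torsion G -> zw_torsion (fun m n => f (G m n)).
Proof.
move=> fB [N GN]; exists N => m n; rewrite -(iter_zw_morph _ _ fB) GN.
by rewrite -{1}(subrr 0) fB subrr.
Qed.

(* The coefficients of - d/dz (z^(c+1) G(z, w)). *)
Lemma zw_torsion_deriv (K : pzRingType) (W : lmodType K) (G : int -> int -> W) c :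
  zw_torsion G -> zw_torsion (fun m n => m%:~R *: G (m + c) n).
Proof.
move=> [N GN]; exists N.+1; elim: N G GN => [|N IH] G GN m n.
  by rewrite /= /zw !(GN _ _ : G _ _ = 0) !scaler0 subrr.
rewrite iterSr; set H := zw _.
(* Leibniz rule: z - w commutes with the derivation up to multiplication by z^(c+1), which leaves a
   term killed by (z - w)^N; hence the exponent N + 1. *)
have -> : H = (fun m n => m%:~R *: @zw W G (m + c) n)
              - (fun m n => - G (m + 1 + c) n).
  apply/funext => p; apply/funext => q; rewrite /H /zw -[RHS]/(_ - - _).
  by rewrite opprK scalerBr intrD scalerDl scale1r [p + c + 1]addrAC [LHS]addrAC.
rewrite (iter_morphB _ (@zwB W)) -[LHS]/(_ - _) IH => [|p q]; last first.
  by rewrite -iterSr.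
have -> : (fun m n => - G (m + 1 + c) n) = 0 - (fun m n => G (m + (1 + c)) n).
  by apply/funext => p; apply/funext => q; rewrite -[RHS]/(0 - _) sub0r addrA.
rewrite (iter_morphB _ (@zwB W)) -[X in _ - X]/(_ - _) iter_zw0 !sub0r opprK.
have shift L p q : iter L (@zw W) (fun m n => G (m + (1 + c)) n) p q =
    iter L (@zw W) G (p + (1 + c)) q.
  by elim: L p q => //= L IHL p q; rewrite /zw !IHL [p + 1 + _]addrAC.
by rewrite shift GN.
Qed.

(** Pascal's rule; it turns the mode-by-mode sum of the locality axiom into an iterate of [zw]. *)
Lemma iter_zw_binom (K : pzRingType) (W : lmodType K) (G : int -> int -> W) N m n :
  iter N (@zw W) G m n = \sum_(j < N.+1)
    ((-1) ^+ j *+ 'C(N, j) : K) *: G (m + N%:Z - j%:Z) (n + j%:Z).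
Proof.
elim: N m n => [|N IH] m n.
  by rewrite big_ord1 /= bin0 expr0 scale1r; congr (G _ _); lia.
rewrite iterS /zw !IH [RHS]big_ord_recl /=.
under [X in _ = _ + X]eq_bigr => i _ do
  rewrite /bump leq0n add1n binS mulrnDr exprS mulN1r scalerDl
          mulNrn [in X in _ + X]mulNrn scaleNr [in X in _ + X]scaleNr.
rewrite big_split /= sumrN addrA; congr (_ + _); last first.
  rewrite -sumrN; apply: eq_bigr => i _; congr (- (_ *: G _ _)); lia.
rewrite [LHS]big_ord_recl big_ord_recr /= (@bin_small N N.+1)//.
rewrite mulr0n scale0r !bin0; congr (_ + _).
  by congr (_ *: G _ _); lia.
rewrite addr0 -sumrN; apply: eq_bigr => i _.
rewrite /bump leq0n add1n exprS mulN1r mulNrn scaleNr.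
congr (- (_ *: G _ _)); lia.
Qed.

(** Only nonnegative powers of w occur, and n = -1 reads the value at w = 0, where (z - w)^N becomes
    z^N. *)
Lemma iter_zw_last (W : zmodType) (G : int -> int -> W) N :
  (forall m n, 0 <= n -> G m n = 0) ->
  forall m, iter N (@zw W) G m (-1) = G (m + N%:Z) (-1).
Proof.
move=> G0; have it0 K m n : 0 <= n -> iter K (@zw W) G m n = 0.
  elim: K m n => [|K IH] m n n0 /=; first exact: G0.
  by rewrite /zw !IH ?subrr//; lia.
elim: N => [|N IH] m; first by rewrite addr0.
by rewrite iterS /zw IH it0// subr0; congr (G _ _); lia.
Qed.

(** If (z - w) G = 0, then G is constant along the lines m + n = const, and sliding to m >= 0 gives
    0. Factors z - w are removed one at a time, since [zw G] also vanishes for m >= 0. *)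
Lemma zw_torsion_eq0 (W : zmodType) (G : int -> int -> W) :
  (forall m n, 0 <= m -> G m n = 0) -> zw_torsion G -> forall m n, G m n = 0.
Proof.
move=> G0 [N]; elim: N G G0 => [|N IH] G G0 GN; first exact: GN.
have zwG m n : zw G m n = 0.
  apply: IH => [p q p0|p q]; last by rewrite -iterSr.
  by rewrite /zw !G0 ?subrr//; lia.
have shift k m n : G m n = G (m + k%:Z) (n - k%:Z).
  elim: k => [|k ->]; first by rewrite addr0 subr0.
  have /eqP := zwG (m + k%:Z) (n - k.+1%:Z); rewrite subr_eq0 => /eqP E.
  have -> : m + k.+1%:Z = m + k%:Z + 1 by lia.
  by rewrite E; congr (G _ _); lia.
by move=> m n; rewrite (shift (absz m)) G0//; lia.
Qed.

End Locality.

(** * Uniqueness, derivatives and brackets of fields on V *)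

Section VertexAlgebra.
Variables (R : realType) (V : lmodType R[i]) (A : vosa V).
Local Notation C := R[i].
Local Notation "a .[ n ]" := (vY A a n) : ring_scope.
Local Notation om := (omega A).
Local Notation "1v" := (vac A).
Implicit Types (a b c u v : V).

Lemma vYDl a b n c : (a + b).[n] c = a.[n] c + b.[n] c.
Proof. by have [_ ->] := linear_morph (vY_linear A n c). Qed.

Lemma vYNl a n c : (- a).[n] c = - a.[n] c.
Proof.
have [_ _ vZ] := linear_morph (vY_linear A n c).
by rewrite -scaleN1r vZ scaleN1r.
Qed.

Lemma T_vac : om.[0] 1v = 0.
Proof. by have [_ ->] := vY_creation A om. Qed.

Lemma T_mode_vac a n : om.[0] (a.[n] 1v) = (- n%:~R) *: a.[n - 1] 1v.
Proof. by rewrite -vY_translation T_vac linear0 subr0. Qed.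

Lemma mode_vac0 a (n : int) : 0 <= n -> a.[n] 1v = 0.
Proof. by have [_] := vY_creation A a; apply. Qed.

Lemma mode_vacN1 a : a.[-1] 1v = a.
Proof. by have [] := vY_creation A a. Qed.

Lemma mode_vacN2 a : a.[-2] 1v = om.[0] a.
Proof. by rewrite -[in RHS](mode_vacN1 a) T_mode_vac mulrN1z opprK scale1r. Qed.

Lemma even_omega : has_parity (vsigma A) false om.
Proof. by rewrite /has_parity vsigma_omega expr0 scale1r. Qed.

Lemma even_vac : has_parity (vsigma A) false 1v.
Proof. by rewrite /has_parity vsigma_vac expr0 scale1r. Qed.

Lemma even_mode a b n : has_parity (vsigma A) false a ->
  has_parity (vsigma A) false b -> has_parity (vsigma A) false (a.[n] b).
Proof.
by rewrite /has_parity vsigma_prod !expr0 !scale1r => -> ->.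
Qed.

(** The exponent is uniform in u: [local_bracket] applies it to vectors such as [c.[k] u] with k
    varying. *)
Lemma even_locality_unif q a b : has_parity (vsigma A) false a ->
  has_parity (vsigma A) q b ->
  exists N, forall u m n,
    iter N (@zw V) (fun m n => a.[m] (b.[n] u) - b.[n] (a.[m] u)) m n = 0.
Proof.
move=> a0 bq; have [N loc] := vY_locality a0 bq; exists N => u m n.
rewrite iter_zw_binom -[RHS](loc m n u); apply: eq_bigr => j _.
by rewrite andFb expr0 scale1r.
Qed.

Lemma even_locality q a b u : has_parity (vsigma A) false a ->
  has_parity (vsigma A) q b ->
  zw_torsion (fun m n => a.[m] (b.[n] u) - b.[n] (a.[m] u)).
Proof. by move=> /even_locality_unif/[apply] -[N /(_ u)]; exists N. Qed.

(* Goddard's uniqueness theorem: with b(-1) vac = b and b(n) vac = 0 for n >= 0,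
   the coefficients of (z - w)^N E(z) b(w) vac = (z - w)^N b(w) E(z) vac = 0
   are the E(m) b. *)
Lemma goddard_uniqueness (E : int -> V -> V) :
  (forall n, {morph E n : u v / u + v}) ->
  (forall n, om.[0] (E n 1v) = (- n%:~R) *: E (n - 1) 1v) ->
  (forall n : int, -1 <= n -> E n 1v = 0) ->
  (forall q b, has_parity (vsigma A) q b ->
     zw_torsion (fun m n => E m (b.[n] 1v) - b.[n] (E m 1v))) ->
  forall n b, E n b = 0.
Proof.
move=> ED ET Epos Eloc.
have E0 n : E n 0 = 0 by exact: morphD0 (ED n).
have E1 n : E n 1v = 0.
  have [n1|n1] := lerP (-1) n; first exact: Epos.
  (* Descent from -1: the translation relation determines n E(n - 1) vac from E(n) vac, and n is
     nonzero in this range. *)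
  have -> : n = -1 - (absz (-1 - n : int))%:Z by lia.
  elim: (absz _) => [|k IH]; first by apply: Epos; lia.
  have := ET (-1 - k%:Z); rewrite IH linear0 => /esym/eqP; rewrite scaler_eq0.
  have -> : -1 - k%:Z - 1 = -1 - k.+1%:Z by lia.
  by rewrite oppr_eq0 intr_eq0 => /orP[|/eqP//]; lia.
have homog q b n : has_parity (vsigma A) q b -> E n b = 0.
  move=> /Eloc[N loc]; have := loc (n - N%:Z) (-1).
  rewrite iter_zw_last => [|m k k0]; last by rewrite mode_vac0// E0 E1 linear0 subrr.
  by rewrite E1 linear0 subr0 mode_vacN1 subrK.
(* Locality is stated against homogeneous vectors, so b is split into its even and odd parts. *)
move=> n b; pose s := vsigma A b.
have -> : b = 2^-1 *: (b + s) + 2^-1 *: (b - s).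
  rewrite -scalerDr addrACA subrr addr0 -mulr2n -[b *+ 2]scaler_nat scalerA.
  by rewrite mulVf ?scale1r// pnatr_eq0.
rewrite ED (homog false) ?(homog true) ?addr0//.
  by rewrite /has_parity linearZ linearB /= vsigmaK expr1 scaleN1r -scalerN opprB.
by rewrite /has_parity linearZ linearD /= vsigmaK expr0 scale1r addrC.
Qed.

Lemma translation_mode a n v : has_parity (vsigma A) false a ->
  (om.[0] a).[n] v = (- n%:~R) *: a.[n - 1] v.
Proof.
move=> a0; apply/eqP; rewrite scaleNr -addr_eq0; apply/eqP.
pose E m u := (om.[0] a).[m] u + m%:~R *: a.[m - 1] u.
apply: (goddard_uniqueness (E := E)) => {n v}.
- by move=> n u v; rewrite /E !linearD /= addrACA.
- move=> n; rewrite /E linearD linearZ /= !T_mode_vac.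
  by rewrite [RHS]scalerDr !scalerA mulrN mulNr.
- move=> n n1; rewrite /E; have [->|nN1] := eqVneq n (-1).
    by rewrite mode_vacN1 mode_vacN2 mulrN1z scaleN1r subrr.
  rewrite mode_vac0; last by lia.
  have [->|n0] := eqVneq n 0; first by rewrite scale0r addr0.
  by rewrite mode_vac0 ?scaler0 ?addr0//; lia.
move=> q b bq.
have loc1 := even_locality 1v (even_mode 0 even_omega a0) bq.
have loc2 := zw_torsion_deriv (-1) (even_locality 1v a0 bq).
have locN := zw_torsion_morph (f := -%R) (fun x y => opprD x (- y)) loc2.
apply: (eq_zw_torsion _ (zw_torsionB loc1 locN)) => m n.
by rewrite opprK scalerBr /E linearD addrACA opprD [X in _ = _ + (_ - X)]linearZ.
Qed.

(* (w - z)^(3N) = (w - z)^N ((x - z) - (x - w))^(2N), where (x - w)^N kills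
   [a(x), b(w)] and (x - z)^N (w - z)^N makes a(x) and b(w) commute with c(z). *)
Lemma local_bracket q a b c p : has_parity (vsigma A) false a ->
  has_parity (vsigma A) false b -> has_parity (vsigma A) q c ->
  let X n u := a.[p] (b.[n] u) - b.[n] (a.[p] u) in
  forall u, zw_torsion (fun n k => X n (c.[k] u) - c.[k] (X n u)).
Proof.
move=> a0 b0 cq X u.
have [i abN] := even_locality_unif a0 b0.
have [j acN] := even_locality_unif a0 cq.
have [l bcN] := even_locality_unif b0 cq.
(* All modes p are kept at once: [P], [Q], [S] multiply by x - w, x - z, w - z, and the first two
   shift p. As [S] fixes p, the conclusion can be read at the given p. *)
pose W := int -> int -> int -> V.
pose P : W -> W := @zw (int -> V).
pose Q : W -> W := fun G p n k => G (p + 1) n k - G p n (k + 1).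
pose S : W -> W := fun G p => zw (G p).
pose G : W := fun p n k =>
  (a.[p] (b.[n] (c.[k] u)) - b.[n] (a.[p] (c.[k] u))) -
  c.[k] (a.[p] (b.[n] u) - b.[n] (a.[p] u)).
have PB : {morph P : F H / F - H} by exact: zwB.
have funW (F H : W) : (forall p n k, F p n k = H p n k) -> F = H.
  by move=> FH; apply/funext => x; apply/funext => y; apply/funext.
have QB : {morph Q : F H / F - H}.
  by move=> F H; apply: funW => x y k; exact: subrACA.
have SB : {morph S : F H / F - H}.
  by move=> F H; apply/funext => x; rewrite /S zwB.
have PQ F : P (Q F) = Q (P F).
  by apply: funW => x y k; exact: subrACA.
have SE F : S F = Q F - P F.
  by apply: funW => x y k; rewrite -[RHS]/(_ - _ - (_ - _)) subrACA subrr sub0r opprB.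
have SQ F : S (Q F) = Q (S F) by rewrite !SE PQ QB.
have iterP N F x y k : iter N P F x y k = iter N (@zw V) (fun x y => F x y k) x y.
  exact: (iter_zw_morph (f := fun H : int -> V => H k)).
have iterQ N F x y k : iter N Q F x y k = iter N (@zw V) (fun x k => F x y k) x k.
  by elim: N x k => //= N IH x k; rewrite /Q !IH.
have iterS N F x : iter N S F x = iter N (@zw V) (F x).
  by elim: N => //= N IH; rewrite /S IH.
have iterSQ N K F : iter N S (iter K Q F) = iter K Q (iter N S F).
  by apply: iter_comm => H; rewrite (iter_comm _ (fun x => esym (SQ x))).
have Q0 : Q 0 = 0 by rewrite -{1}(subrr 0) QB subrr.
have S0 : S 0 = 0 by rewrite -{1}(subrr 0) SB subrr.
have PG : iter i P G = 0.
  apply: funW => x y k; rewrite iterP.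
  have -> : (fun x y => G x y k) =
      (fun x y => a.[x] (b.[y] (c.[k] u)) - b.[y] (a.[x] (c.[k] u))) -
      (fun x y => c.[k] (a.[x] (b.[y] u) - b.[y] (a.[x] u))) by [].
  rewrite (iter_morphB _ (@zwB V)) -[LHS]/(_ - _) abN.
  by rewrite -(iter_zw_morph _ _ (linearB (vY A c k))) abN linear0 subrr.
(* By Jacobi, [[a, b], c] = [a, [b, c]] - [b, [a, c]]: [G1] and [G4] contain [b, c] and die under a
   power of [S], [G2] and [G3] contain [a, c] and die under a power of [Q]. *)
pose G1 : W := fun p n k => a.[p] (b.[n] (c.[k] u) - c.[k] (b.[n] u)).
pose G2 : W := fun p n k => a.[p] (c.[k] (b.[n] u)) - c.[k] (a.[p] (b.[n] u)).
pose G3 : W := fun p n k => b.[n] (a.[p] (c.[k] u) - c.[k] (a.[p] u)).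
pose G4 : W := fun p n k => b.[n] (c.[k] (a.[p] u)) - c.[k] (b.[n] (a.[p] u)).
have SG1 : iter l S G1 = 0.
  apply: funW => x y k; rewrite iterS -(iter_zw_morph _ _ (linearB (vY A a x))).
  by rewrite bcN linear0.
have SG4 : iter l S G4 = 0 by apply: funW => x y k; rewrite iterS bcN.
have QG2 : iter j Q G2 = 0 by apply: funW => x y k; rewrite iterQ acN.
have QG3 : iter j Q G3 = 0.
  apply: funW => x y k; rewrite iterQ -(iter_zw_morph _ _ (linearB (vY A b y))).
  by rewrite acN linear0.
have GE : G = (G1 - G4) - (G3 - G2).
  apply: funW => x y k; rewrite -[RHS]/(_ - _ - (_ - _)) /G /G1 /G2 /G3 /G4.
  rewrite (linearB (vY A c k)) (linearB (vY A a x)) (linearB (vY A b y)) /=.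
  exact: commutator_split.
exists (l + i + j)%N => n k; rewrite -[RHS]/((0 : W) p n k).
rewrite -(iter_sub_kernel PB QB PQ SE PG (a := l) (j := j)) ?iterS//.
have iterQB := iter_morphB j QB.
rewrite GE (iterQB (G1 - G4)) (iterQB G1) (iterQB G3) QG2 QG3 subrr subr0.
rewrite (iter_morphB _ SB) !iterSQ.
by rewrite SG1 SG4 iter_fix ?subrr.
Qed.

(** * Brackets of Virasoro and Heisenberg modes *)

Section Heisenberg.
Variables (h : V) (xi : C).
Hypothesis hh : is_heisenberg A h xi.

(** Induction on p: since [omega(0), omega(p + 1)] = -(p + 1) omega(p), the translation relation
    required of [E] at p + 1 follows from the formula at p. *)
Lemma heis_commutator_nat (p : nat) n v :
  om.[p%:Z] (h.[n] v) - h.[n] (om.[p%:Z] v) = (- n%:~R) *: h.[p%:Z + n - 1] v.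
Proof.
have [h0 [L0h [_ [Lnh _]]]] := hh.
elim: p n v => [|p IH] n v; first by rewrite add0r vY_translation.
apply/eqP; rewrite scaleNr -addr_eq0; apply/eqP.
pose E m u := om.[p.+1] (h.[m] u) - h.[m] (om.[p.+1] u)
              + m%:~R *: h.[p.+1%:Z + m - 1] u.
have E1 m : E m 1v = om.[p.+1] (h.[m] 1v) + m%:~R *: h.[p.+1%:Z + m - 1] 1v.
  by rewrite /E [om.[_] 1v]mode_vac0// linear0 subr0.
apply: (goddard_uniqueness (E := E)) => {n v}.
- move=> n u v; rewrite /E !(linearD (vY A _ _)) scalerDr [RHS]addrACA.
  by congr (_ + _); rewrite opprD; exact: addrACA.
- move=> n; rewrite !E1 linearD linearZ /= T_mode_vac.
  have /eqP := vY_translation A om p.+1 (h.[n] 1v); rewrite subr_eq => /eqP ->.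
  have -> : p.+1%:Z - 1 = p%:Z by lia.
  have /eqP := IH n 1v; rewrite [om.[p%:Z] 1v]mode_vac0// linear0 subr0 => /eqP ->.
  rewrite T_mode_vac linearZ /= [RHS]scalerDr !scalerA.
  have -> : p%:Z + n - 1 = p.+1%:Z + n - 1 - 1 by lia.
  have -> : p.+1%:Z + (n - 1) - 1 = p.+1%:Z + n - 1 - 1 by lia.
  rewrite [X in X + _ = _]addrC -addrA -scalerDl; congr (_ + _ *: _).
    by rewrite linearZ.
  by rewrite !rmorphB rmorphD /=; ring.
(* At n = -1 the claim is omega(p + 1) h = h(p - 1) vac, that is L(0) h = h for p = 0 and L(p) h = 0
   for p > 0. *)
- move=> n n1; rewrite E1; have [->|nN1] := eqVneq n (-1).
    rewrite mode_vacN1 mulrN1z scaleN1r; case: p {IH E E1} => [|p].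
      by rewrite L0h mode_vacN1 subrr.
    have := Lnh p.+1%:Z; rewrite -[p.+2%:Z]/(1 + p.+1)%:Z addrC => -> //.
    by rewrite mode_vac0 ?subrr//; lia.
  by rewrite !mode_vac0 ?linear0 ?scaler0 ?addr0//; lia.
move=> q b bq.
have loc1 := local_bracket p.+1%:Z even_omega h0 bq 1v.
have loc2 := zw_torsion_deriv (p.+1%:Z - 1) (even_locality 1v h0 bq).
have locN := zw_torsion_morph (f := -%R) (fun x y => opprD x (- y)) loc2.
apply: (eq_zw_torsion _ (zw_torsionB loc1 locN)) => m n /=.
have -> : m + (p.+1%:Z - 1) = p.+1%:Z + m - 1 by lia.
rewrite opprK scalerBr /E !(linearD (vY A b n)) (linearZ_LR (vY A b n)) /=.
by rewrite [LHS]addrACA -opprD.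
Qed.

(** The difference of the two sides is killed by a power of z - w and vanishes for p >= 0, hence
    everywhere. *)
Lemma heis_commutator p n v :
  om.[p] (h.[n] v) - h.[n] (om.[p] v) = (- n%:~R) *: h.[p + n - 1] v.
Proof.
have [h0 _] := hh.
apply/eqP; rewrite -subr_eq0; apply/eqP; move: p n.
apply: (zw_torsion_eq0 (G := fun p n => om.[p] (h.[n] v) - h.[n] (om.[p] v)
                                       - (- n%:~R) *: h.[p + n - 1] v)).
  move=> m n m0; have -> : m = (absz m)%:Z by lia.
  by rewrite heis_commutator_nat subrr.
apply: zw_torsionB; first exact: even_locality even_omega h0.
(* The right-hand side is a first derivative of a delta function: one factor z - w leaves h(m + n),
   which depends on m + n only, and a second kills it. *)
exists 2 => m n; rewrite /= /zw.
have E p q : (- q%:~R : C) *: h.[p + 1 + q - 1] v -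
      (- (q + 1)%:~R) *: h.[p + (q + 1) - 1] v
    = h.[p + q] v.
  have -> : p + 1 + q - 1 = p + q by lia.
  have -> : p + (q + 1) - 1 = p + q by lia.
  by rewrite -scalerBl opprK intrD addKr scale1r.
by rewrite !E addrA [m + n + 1]addrAC subrr.
Qed.

(** The commutator at p = -1 on the vacuum, where omega(-1) vac = omega and h(n) vac = 0; it stands
    in for skew-symmetry. *)
Lemma heis_omega n : 0 <= n -> h.[n] om = n%:~R *: h.[n - 2] 1v.
Proof.
move=> n0; have := heis_commutator (-1) n 1v.
rewrite mode_vacN1 mode_vac0// linear0 sub0r scaleNr => /oppr_inj ->.
by congr (_ *: (vY A h) _ _); lia.
Qed.

Lemma omega_sh_mode1 v : (omega_sh A h).[1] v = om.[1] v - h.[0] v.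
Proof.
have [h0 _] := hh.
by rewrite /omega_sh vYDl mode_vacN2 translation_mode// mulr1z scaleN1r.
Qed.

End Heisenberg.

End VertexAlgebra.

(** * The exponential and coefficients of exponential sums *)

Section Exponential.
Variable R : realType.
Local Notation C := R[i].

Lemma cexpD (z w : C) : cexp (z + w) = cexp z * cexp w.
Proof.
case: z w => [a b] [c d]; rewrite /cexp /= expRD cosD sinD.
by apply/eqP; rewrite eq_complex /=; apply/andP; split; apply/eqP; ring.
Qed.

Lemma cexp0 : cexp (0 : C) = 1.
Proof. by rewrite /cexp /= expR0 cos0 sin0 mul1r. Qed.

Lemma cexpVN (z : C) : cexp (- z) * cexp z = 1.
Proof. by rewrite -cexpD addNr cexp0. Qed.

Lemma cexp_neq0 (z : C) : cexp z != 0.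
Proof.
by apply/eqP => z0; have /eqP := cexpVN z; rewrite z0 mulr0 eq_sym oner_eq0.
Qed.

Lemma cexpN (z : C) : cexp (- z) = (cexp z)^-1.
Proof. by apply: (mulIf (cexp_neq0 z)); rewrite cexpVN mulVf ?cexp_neq0. Qed.

Lemma cexpMn n (z : C) : cexp (n%:R * z) = cexp z ^+ n.
Proof.
elim: n => [|n IH]; first by rewrite mul0r cexp0.
by rewrite -addn1 natrD mulrDl mul1r cexpD IH addn1 exprSr.
Qed.

Lemma cexp1_neq1 : cexp (1 : C) != 1.
Proof.
rewrite /cexp /= cos0 sin0 mulr1 eq_complex /= eqxx andbT.
by rewrite gt_eqF// expR_gt1.
Qed.

(** At z = 1 / (s - t) the two exponentials would differ by the factor e, which is not 1. *)
Lemma cexp_char_inj (s t : C) : (forall z, cexp (s * z) = cexp (t * z)) -> s = t.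
Proof.
move=> st; apply/eqP; rewrite -subr_eq0; apply: contraT => d0.
have := cexp1_neq1; rewrite -{1}(divff d0) mulrBl cexpD st -mulNr -cexpD.
by rewrite mulNr subrr cexp0 eqxx.
Qed.

Section Coefficients.
Variable V : lmodType C.

Definition shift (x : C) (F : C -> V) : C -> V := fun z => F (x + z).

Lemma shift_is_linear x : linear (shift x).
Proof. by []. Qed.

HB.instance Definition _ x :=
  GRing.isLinear.Build C (C -> V) (C -> V) *:%R (shift x) (shift_is_linear x).

(** The functions e^(t zeta) d(t) are joint eigenvectors of all translations with distinct
    characters; evaluation at 0 recovers d(t). *)
Lemma exponentials_free (s : seq C) (d : C -> V) : uniq s ->
  (forall zeta, \sum_(t <- s) cexp (t * zeta) *: d t = 0) ->
  forall t, t \in s -> d t = 0.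
Proof.
move=> us sum0 t ts; pose e t : C -> V := fun z => cexp (t * z) *: d t.
suff : e t = 0.
  by move=> /(congr1 (@^~ 0)); rewrite /e mulr0 cexp0 scale1r.
apply: (joint_eigenvectors_free (T := fun x => shift x : {linear _ -> _})
          cexp_char_inj us (e := e)) => //.
  move=> r x; apply/funext => z; rewrite -[RHS]/(_ *: (_ *: _)) scalerA -cexpD.
  by rewrite -mulrDr.
by apply/funext => z; rewrite fct_sumE sum0.
Qed.

Lemma zcoefE (F : C -> V) (d : C -> V) (s : seq C) r : uniq s ->
  (forall t, t \notin s -> d t = 0) ->
  (forall zeta, F zeta = \sum_(t <- s) cexp (t * zeta) *: d t) ->
  zcoef F r = d r.
Proof.
move=> us ds FE; rewrite /zcoef; apply: xget_unique.
  exists d; split=> //.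
    apply: (@sub_finite_set _ _ [set` s]%classic) => // t /=.
    by apply: contra_neqT => /ds.
  move=> zeta; rewrite FE (@fsum_seq _ _ setT _ s)// => t _ /ds ->.
  by rewrite scaler0.
move=> w [d' [/finite_support_seq[s' [us' ds']] FE' ->]].
pose q := undup (s ++ s').
have E t : t \notin q -> d t = 0 /\ d' t = 0.
  by rewrite mem_undup mem_cat negb_or => /andP[/ds ? /ds'].
have [rq|/E[-> ->]//] := boolP (r \in q).
apply/eqP; rewrite -subr_eq0; apply/eqP.
apply: (@exponentials_free q (fun t => d' t - d t)) => //; first exact: undup_uniq.
move=> zeta; under eq_bigr do rewrite scalerBr.
rewrite sumrB; apply/eqP; rewrite subr_eq0; apply/eqP.
rewrite -(@fsum_seq _ _ setT) ?undup_uniq//; last by move=> t _ /E[_ ->]; rewrite scaler0.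
rewrite -FE' FE -(@fsum_seq _ _ setT _ s)//; last by move=> t _ /ds ->; rewrite scaler0.
rewrite (@fsum_seq _ _ setT _ q) ?undup_uniq// => t _ /E[-> _].
by rewrite scaler0.
Qed.

End Coefficients.
End Exponential.

(** The iterates are intertwined one by one, and injectivity of [S] preserves the support, so the
    two values agree even where that support is infinite. *)
Lemma lnexp_conj (R : realType) (V : lmodType R[i]) (S N1 N2 : V -> V) :
  injective S -> linear S -> (forall v, S (N1 v) = N2 (S v)) ->
  forall v, S (lnexp N1 v) = lnexp N2 (S v).
Proof.
move=> Sinj Slin SN v.
have [S0 SD SZ] := linear_morph Slin.
rewrite /lnexp (fsum_inj _ _ Sinj S0 SD).
apply: eq_fsbigr => k _; rewrite SZ; congr (_ *: _).
by elim: k => //= k <-.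
Qed.

(** * Delta(-h, z), U and the shifted grading *)

Section ShiftedModule.
Variables (R : realType) (V : lmodType R[i]) (A : vosa V).
Variables (h : V) (xi : R[i]).
Hypothesis hh : is_heisenberg A h xi.
Local Notation C := R[i].
Local Notation "a .[ n ]" := (vY A a n) : ring_scope.
Local Notation om := (omega A).
Local Notation "1v" := (vac A).
Implicit Types (u v : V) (zeta : C).
Local Open Scope classical_set_scope.

Let pos : set nat := [set n | (0 < n)%N].

Lemma diagonalizable_L0 : exists P, diagonalizable_on om.[1] P.
Proof. by have [r0 d] := vgrading A; eexists; exact: d. Qed.

Lemma diagonalizable_h0 : exists P, diagonalizable_on (- h).[0] P.
Proof.
have [_ [_ [dh _]]] := hh; exists setT => v.
have [m [u [lam [hu ->]]]] := dh v; exists m, u, (fun i => - lam i); split=> // i.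
by split=> //; rewrite vYNl (hu i).2 scaleNr.
Qed.

Lemma L0_h0 u : om.[1] ((- h).[0] u) = (- h).[0] (om.[1] u).
Proof.
have := heis_commutator hh 1 0 u; rewrite oppr0 scale0r => /eqP.
by rewrite subr_eq0 !vYNl linearN /= => /eqP ->.
Qed.

Lemma omega_sh_mode1E u : (omega_sh A h).[1] u = om.[1] u + (- h).[0] u.
Proof. by rewrite (omega_sh_mode1 hh) vYNl. Qed.

Lemma diagonalizable_Lh0 : diagonalizable_on (omega_sh A h).[1] setT.
Proof.
have [P dL] := diagonalizable_L0; have [_ [_ [dh _]]] := hh.
apply: (diagonalizable_sub dL dh) => u; last exact: omega_sh_mode1 hh u.
have := L0_h0 u; rewrite !vYNl linearN /=; exact: oppr_inj.
Qed.

(** Checked on joint eigenvectors of L(0) and -h(0), which exist since the two commute, and whose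
    eigenvalues add. *)
Lemma qpow_omega_sh zeta v :
  qpow zeta (- h).[0] (qpow zeta om.[1] v) = qpow zeta (omega_sh A h).[1] v.
Proof.
have [P dL] := diagonalizable_L0; have [P' dh] := diagonalizable_h0.
have [_ LD _] := linear_morph (opfun_linear (fun lam => cexp (zeta * lam)) dL).
have [_ hD hZ] := linear_morph (opfun_linear (fun lam => cexp (zeta * lam)) dh).
have [_ KD _] := linear_morph
  (opfun_linear (fun lam => cexp (zeta * lam)) diagonalizable_Lh0).
move: v; apply: (joint_diagonalizable_ind dL dh L0_h0) => [u w|u lam mu Lu hu].
  by rewrite /qpow LD hD KD => -> ->.
rewrite /qpow (opfun_eigen _ Lu) hZ (opfun_eigen _ hu).
rewrite (@opfun_eigen _ _ _ _ u (lam + mu)) ?omega_sh_mode1E ?Lu ?hu ?scalerDl//.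
by rewrite scalerA mulrDr cexpD.
Qed.

Lemma qpow_L0K zeta v : qpow (- zeta) om.[1] (qpow zeta om.[1] v) = v.
Proof.
have [P dL] := diagonalizable_L0; have [m [u [lam [Lu ->]]]] := dL v.
have {}Lu i := (Lu i).2; rewrite {2}/qpow (opfun_sum _ Lu) /qpow.
rewrite (@opfun_sum _ _ _ _ _ _ lam) => [|i]; last first.
  by rewrite linearZ /= Lu !scalerA mulrC.
apply: eq_bigr => i _; rewrite scalerA mulNr -cexpD addNr cexp0.
exact: scale1r.
Qed.

(** By [L(0), h(n)] = -n h(n), the mode h(n) lowers L(0)-eigenvalues by n. *)
Lemma qpow_L0_mode zeta n v :
  qpow zeta om.[1] (h.[n] v) = cexp (- n%:~R * zeta) *: h.[n] (qpow zeta om.[1] v).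
Proof.
have [P dL] := diagonalizable_L0; have [m [u [lam [Lu ->]]]] := dL v.
have {}Lu i := (Lu i).2; rewrite {2}/qpow (opfun_sum _ Lu) !linear_sum /qpow.
rewrite (@opfun_sum _ _ _ _ _ _ (fun i => lam i - n%:~R)) => [|i /=].
  apply: eq_bigr => i _ /=; rewrite [in RHS]linearZ scalerA.
  by rewrite -cexpD mulrBr addrC mulNr [n%:~R * _]mulrC.
have /eqP := heis_commutator hh 1 n (u i); rewrite subr_eq => /eqP ->.
have -> : 1 + n - 1 = n by lia.
by rewrite Lu linearZ /= -scalerDl addrC.
Qed.

(* The exponent of Delta(-h, z), z = e^zeta. *)
Let N zeta u := \sum_(n \in pos) ((- cexp zeta) ^- n / n%:R) *: h.[n%:Z] u.

Lemma DeltaNE zeta v :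
  Delta A (- h) zeta v = qpow zeta (- h).[0] (lnexp (N zeta) v).
Proof.
rewrite /Delta; set D := (X in lnexp X); suff -> : D = N zeta by [].
apply/funext => u; rewrite /D.
rewrite (fsum_inj _ _ (@oppr_inj V) (oppr0 V) (@opprD V)).
by apply: eq_fsbigr => n _; rewrite vYNl scalerN opprK.
Qed.

Lemma UopE v : Uop A h v = lnexp (N 0) v.
Proof.
rewrite /Uop; set D := (X in lnexp X); suff -> : D = N 0 by [].
apply/funext => u; apply: eq_fsbigr => n _.
by rewrite cexp0 -exprVn invrN1.
Qed.

Lemma Delta0 v : Delta A (- h) 0 v = Uop A h v.
Proof.
rewrite DeltaNE UopE; move: (lnexp _ _) => w.
have [P' dh] := diagonalizable_h0; have [m [u [lam [hu ->]]]] := dh w.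
rewrite /qpow (opfun_sum _ (fun i => (hu i).2)); apply: eq_bigr => i _.
by rewrite mul0r cexp0 scale1r.
Qed.

Lemma Delta_qpow_L0 zeta v : Delta A (- h) zeta (qpow zeta om.[1] v) =
  qpow zeta (omega_sh A h).[1] (Uop A h v).
Proof.
rewrite DeltaNE UopE -qpow_omega_sh; congr (qpow _ _ _).
have [P dL] := diagonalizable_L0; pose S := qpow zeta om.[1].
have Slin : linear S := opfun_linear _ dL.
have Sinj : injective S := can_inj (qpow_L0K zeta).
have [S0 SD SZ] := linear_morph Slin.
(* Moving h(n) across [S] costs z^-n, which turns the coefficients (-1)^-n / n of [N 0] into the
   (-z)^-n / n of [N zeta]. *)
apply/esym/(lnexp_conj Sinj Slin) => {}v.
rewrite /N (fsum_inj _ _ Sinj S0 SD).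
apply: eq_fsbigr => n _; rewrite SZ /S qpow_L0_mode scalerA; congr (_ *: _).
rewrite cexp0 mulrAC; congr (_ / _).
by rewrite mulNr cexpN cexpMn -invfM -exprMn mulN1r.
Qed.

Lemma N_mode1 zeta u : (forall n : nat, (1 < n)%N -> h.[n%:Z] u = 0) ->
  N zeta u = (- cexp zeta)^-1 *: h.[1] u.
Proof.
move=> u0; rewrite /N (@fsum_seq _ _ _ _ [:: 1%N])//= ?big_seq1 ?divr1//.
  by move=> i; rewrite inE => /eqP ->.
by move=> [|[|n]]// _ _; rewrite u0 ?scaler0.
Qed.

(** The exponent sends omega to -z^-1 h, h to -z^-1 xi vac and vac to 0, so the exponential stops at
    the square, whose factor 1/2! produces xi / 2. *)
Lemma Delta_omega zeta : Delta A (- h) zeta om =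
  om - cexp (- zeta) *: h + cexp (- (2 * zeta)) *: ((xi / 2) *: 1v).
Proof.
have [_ [_ [_ [_ [hnh _]]]]] := hh.
have hvac (n : int) : 0 <= n -> h.[n] 1v = 0 by exact: mode_vac0.
set x := (- cexp zeta)^-1.
have N1 : N zeta om = x *: h.
  rewrite N_mode1 => [|n n1]; rewrite (heis_omega hh)//.
    by rewrite mulr1z scale1r (_ : 1 - 2 = -1 :> int)// mode_vacN1.
  by rewrite hvac ?scaler0//; lia.
have N2 : N zeta (x *: h) = (x ^+ 2 * xi) *: 1v.
  rewrite N_mode1 => [|n n1]; rewrite linearZ /= hnh//.
    by rewrite /= !scalerA expr2.
  by rewrite ifF ?scaler0//; lia.
have N3 a : N zeta (a *: 1v) = 0.
  by rewrite N_mode1 => [|n n1]; rewrite linearZ /= hvac// !scaler0.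
have iterN k : iter k.+3 (N zeta) om = 0.
  elim: k => [|k IH]; first by rewrite /= N1 N2 N3.
  by rewrite iterS IH -(scale0r 1v) N3 scale0r.
rewrite DeltaNE /lnexp (@fsum_seq _ _ _ _ [:: 0; 1; 2]%N)//; last first.
  by move=> [|[|[|k]]]// _ _; rewrite iterN scaler0.
rewrite !big_cons big_nil /= N1 N2 addr0.
set w := (X in qpow _ _ X).
(* h(0) kills omega, h and vac, so z^(-h(0)) fixes [w]. *)
have -> : qpow zeta (- h).[0] w = w.
  rewrite /qpow (@opfun_eigen _ _ _ _ w 0) ?mulr0 ?cexp0 ?scale1r//.
  rewrite vYNl scale0r /w !linearD !linearZ /= (heis_omega hh)// hnh// (hvac 0)//.
  by rewrite mulr0z scale0r /= !oppr0 !scaler0 !addr0.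
rewrite /w /x invr1 !scale1r addrA; congr (_ + _ + _).
  by rewrite invrN scaleNr cexpN.
rewrite !scalerA; congr (_ *: _).
rewrite invrN sqrrN cexpN cexpMn exprVn mulrCA.
by congr (_ * _); rewrite mulrC.
Qed.

(** * The two grading operators on M *)

Section OnModule.
Variables (M : lmodType C) (B : vmodule A M).

Lemma mY0l n (u : M) : mY B 0 n u = 0.
Proof. by have [-> ] := linear_morph (mY_linear B n u). Qed.

Lemma mYDl a b n (u : M) : mY B (a + b) n u = mY B a n u + mY B b n u.
Proof. by have [_ -> ] := linear_morph (mY_linear B n u). Qed.

Lemma mYZl k a n (u : M) : mY B (k *: a) n u = k *: mY B a n u.
Proof. by have [_ _ ->] := linear_morph (mY_linear B n u). Qed.

(** Borcherds identity for h and vac at l = -2, m = 0, n = 1: m = 0 leaves j = 0 on the left, and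
    the vacuum modes leave only -h(0) u on the right. *)
Lemma mY_omega_sh (u : M) : mY B (omega_sh A h) 1 u = mY B om 1 u - mY B h 0 u.
Proof.
have [h0 _] := hh; rewrite /omega_sh mYDl; congr (_ + _).
have := mY_jacobi B h0 (even_vac A) (-2) 0 1 u.
rewrite (@fsum_seq _ _ _ _ [:: 0%N])//; last first.
  move=> [|j]// _ _; rewrite /gbinom big_ord_recl /= subrr mul0r mul0r.
  exact: scale0r.
rewrite (@fsum_seq _ _ _ _ [:: 0%N])//; last first.
  move=> [|j]// _ _; rewrite !mY_vac.
  have -> : (1 + j.+1%:Z == -1) = false by lia.
  have -> : (-2 + 1 - j.+1%:Z == -1) = false by lia.
  by rewrite linear0 scaler0 subr0 scaler0.
rewrite !big_seq1 /gbinom !big_ord0 !addr0 fact0 invr1 !mulr1 !scale1r => ->.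
rewrite !mY_vac /= linear0 sub0r [_ ^ _](_ : _ = 1) ?scale1r//.
by rewrite -exprnN sqrrN expr1n invr1.
Qed.

Lemma Lg0E (u : M) : Lg0 B h u = mY B om 1 u - mY B h 0 u + (xi / 2) *: u.
Proof.
pose d (t : C) := if t == 0 then om else if t == -1 then - h
                  else if t == -2 then (xi / 2) *: 1v else 0.
have n10 : (-1 == 0 :> C) = false by rewrite oppr_eq0 oner_eq0.
have n20 : (-2 == 0 :> C) = false by rewrite oppr_eq0 pnatr_eq0.
have n21 : (-2 == -1 :> C) = false by rewrite eqr_opp (eqr_nat _ 2 1).
have uq : uniq [:: 0; -1; -2 : C].
  by rewrite /= !inE !(eq_sym 0) n10 n20 (eq_sym (-1)) n21.
have dE r : zcoef (fun zeta => Delta A (- h) zeta om) r = d r.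
  apply: (zcoefE r uq) => [t|zeta].
    by rewrite /d !inE !negb_or => /and3P[/negPf -> /negPf -> /negPf ->].
  rewrite !big_cons big_nil /d eqxx n10 eqxx n20 n21 eqxx Delta_omega addr0.
  by rewrite mul0r cexp0 scale1r !mulNr mul1r scalerN addrA.
(* z^s z^(-k-1) = z^-2 forces s = k - 1, so the exponents 0, -1, -2 pair with omega(1), h(0) and
   vac(-1). *)
have dk (k : int) : d (-2 + (k + 1)%:~R) =
    if k == 1 then om else if k == 0 then - h
    else if k == -1 then (xi / 2) *: 1v else 0.
  have -> : -2 + (k + 1)%:~R = (k - 1)%:~R :> C by rewrite rmorphD rmorphB /=; ring.
  have E (m : int) : ((k - 1)%:~R == m%:~R :> C) = (k == m + 1).
    by rewrite eqr_int subr_eq.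
  by rewrite /d (E 0) (E (-1)) (E (-2)).
rewrite /Lg0 /Yg_coef (@fsum_seq _ _ _ _ [:: 1; 0; -1])//; last first.
  move=> k _; rewrite !inE !negb_or dE dk => /and3P[/negPf -> /negPf -> /negPf ->].
  exact: mY0l.
rewrite !big_cons big_nil !dE !dk /= addr0 mYZl mY_vac /= addrA.
by rewrite -(scaleN1r h) mYZl scaleN1r.
Qed.

End OnModule.
End ShiftedModule.

Theorem proposition4p3 (R : realType) (V : lmodType R[i]) (A : vosa V)
    (h : V) (xi : R[i]) (hh : is_heisenberg A h xi)
    (M : lmodType R[i]) (B : vmodule A M)
    (hdiag : diagonalizable_on (Lg0 B h) (fun _ => True))
    (hfin : findim_eigenspaces (Lg0 B h))
    (f : {linear V -> V}) (hf : is_automorphism A f)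
    (hfg : forall v, f (heis_aut A h v) = heis_aut A h (f v))
    (hfs : forall v, f (vsigma A v) = vsigma A (f v))
    (fM : {linear M -> M}) (hfM : acts_on_module B f fM)
    (n : nat) (v : 'I_n -> V) (z : 'I_n -> R[i]) (tau : R[i]) :
  (forall a, Delta A (- h) 0 a = Uop A h a) /\
  (forall r k, twisted_series B fM h v z r k =
               shifted_series B fM h xi (fun i => Uop A h (v i)) z r k) /\
  ((exists w, nsum (twisted_series B fM h v z) tau w) <->
   (exists w, nsum (shifted_series B fM h xi (fun i => Uop A h (v i)) z) tau w)) /\
  F_twisted B fM h v z tau =
  F_shifted B fM h xi (fun i => Uop A h (v i)) z tau.
Proof.
have series : twisted_series B fM h v z =
    shifted_series B fM h xi (fun i => Uop A h (v i)) z.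
  rewrite /twisted_series /shifted_series; congr (nterm _ _ _ _).
    by apply/funext => i; rewrite /Yg_at (Delta_qpow_L0 hh).
  apply/funext => u; rewrite (Lg0E hh) (mY_omega_sh hh) -addrA; congr (_ + _).
  (* xi / 2 - c / 24 = -(c - 12 xi) / 24: the shift of the central charge absorbs the constant of
     L_g(0). *)
  by rewrite -scalerBl -[RHS]scaleNr /charge_sh; congr (_ *: _); field.
split; first exact: Delta0 hh.
by rewrite /F_twisted /F_shifted series.
Qed.
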